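(* There exists a constant $c$ such that for every integer $d \ge 2$, the $d$-dimensional hypercube $H_d$ satisfies $\mathrm{box}(H_d) \le \frac{c\,d}{\log d}$.
   Context: The $d$-dimensional hypercube $H_d$ is the graph whose vertices correspond to the $2^d$ binary strings of length $d$, two vertices being adjacent if and only if the corresponding strings differ in exactly one bit position. A $k$-dimensional (axis-parallel) box is a Cartesian product $R_1 \times R_2 \times \cdots \times R_k$ where each $R_i$ is a closed interval of the form $[a_i, b_i]$ on the real line. A finite simple graph $G$ is representable as the intersection graph of a family of sets $(S_x)_{x \in V(G)}$ if two distinct vertices $x,y$ are adjacent in $G$ if and only if $S_x \cap S_y \neq \emptyset$. The boxicity $\mathrm{box}(G)$ is the minimum $k$ such that $G$ is representable as the intersection graph of axis-parallel boxes in $k$-dimensional space. *)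

(* Defs.v *)
From HB Require Import structures.
From mathcomp Require Import all_boot all_order all_algebra.
From mathcomp Require Import all_classical all_reals.

Set Implicit Arguments.
Unset Strict Implicit.
Unset Printing Implicit Defensive.

Import Order.TTheory GRing.Theory Num.Theory.

Local Open Scope classical_set_scope.
Local Open Scope ring_scope.

Record sgraph := SGraph {
  vertex :> finType;
  adj : rel vertex;
  adj_sym : symmetric adj;
  adj_irrefl : irreflexive adj
}.

(* The intervals [a i, b i] are nonempty. For k = 0 the only box is the
   one-point space, so the graphs of boxicity 0 are the complete graphs. *)
Definition is_box (R : realType) (k : nat) (S : set 'rV[R]_k) : Prop :=
  exists a b : 'rV[R]_k, (forall i, a ord0 i <= b ord0 i) /\
    S = [set p | forall i, p ord0 i \in `[a ord0 i, b ord0 i]].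

Definition intersection_graph_of (G : sgraph) (P : Type) (S : G -> set P) :
    Prop :=
  forall x y : G, x != y -> (adj x y <-> S x `&` S y !=set0).

Definition box_representable (R : realType) (G : sgraph) (k : nat) : Prop :=
  exists S : G -> set 'rV[R]_k,
    (forall x, is_box (S x)) /\ intersection_graph_of S.

(* One coordinate per vertex v: v is sent to [0, 0], its neighbours to [0, 1]
   and all other vertices to [1, 1]. *)
Lemma box_representable_card (R : realType) (G : sgraph) :
  box_representable R G #|G|.
Proof.
pose a (x : G) : 'rV[R]_#|G| :=
  \row_i (if (x == enum_val i) || adj (enum_val i) x then 0 else 1).
pose b (x : G) : 'rV[R]_#|G| := \row_i (if x == enum_val i then 0 else 1).
exists (fun x => [set p | forall i, p ord0 i \in `[a x ord0 i, b x ord0 i]]).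
split=> [x|x y nxy].
  exists (a x), (b x); split=> // i; rewrite !mxE.
  by case: (x == _); case: (adj _ x); rewrite /= ?lexx ?ler01.
split=> [axy|[p [px py]]].
  exists (\row_i (if (x == enum_val i) || (y == enum_val i) then 0 else 1)).
  split=> i; rewrite in_itv /= !mxE.
    case: (eqVneq x (enum_val i)) => [_|_] /=; first by rewrite lexx.
    case: (eqVneq y (enum_val i)) => [<-|_] /=.
      by rewrite adj_sym axy lexx ler01.
    by case: (adj _ x); rewrite ?lexx ?ler01.
  case: (eqVneq y (enum_val i)) => [_|_] /=; first by rewrite orbT lexx.
  case: (eqVneq x (enum_val i)) => [<-|_] /=; first by rewrite axy lexx ler01.
  by case: (adj _ y); rewrite ?lexx ?ler01.
have := px (enum_rank x); have := py (enum_rank x).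
rewrite !in_itv /= !mxE enum_rankK eqxx eq_sym (negPf nxy) /=.
case: (adj x y) => // /andP[p1 _] /andP[_ p0].
by have := le_trans p1 p0; rewrite ler10.
Qed.

Lemma box_representable_ex (R : realType) (G : sgraph) :
  exists k, `[< box_representable R G k >].
Proof. by exists #|G|; apply/asboolP; exact: box_representable_card. Qed.

Definition boxicity (R : realType) (G : sgraph) : nat :=
  ex_minn (box_representable_ex R G).

Section Hypercube.
Variable d : nat.

Definition hypercube_adj : rel (d.-tuple bool) :=
  fun x y => #|[set i : 'I_d | tnth x i != tnth y i]%SET| == 1%N.

Lemma hypercube_adj_sym : symmetric hypercube_adj.
Proof.
move=> x y; rewrite /hypercube_adj; congr (_ == _); apply: eq_card => i.
by rewrite !inE eq_sym.
Qed.

Lemma hypercube_adj_irrefl : irreflexive hypercube_adj.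
Proof.
move=> x; rewrite /hypercube_adj (eq_card (B := pred0)) ?card0 // => i.
by rewrite !inE eqxx.
Qed.

Definition hypercube : sgraph := SGraph hypercube_adj_sym hypercube_adj_irrefl.

End Hypercube.

(* Main.v *)
Require Import Defs.
From mathcomp Require Import all_boot all_order all_algebra.
From mathcomp Require Import zify ring lra.

(** A set [S] of coordinates, read as a sign vector, maps a vertex [x] to the
    sum of the signs of its nonzero coordinates and gives the unit interval
    starting at that number.  Adjacent vertices always get intersecting
    intervals.  Two vertices which differ in a set [D] of [m >= 2] coordinates
    are separated unless the signs nearly cancel on [D], which happens for a
    proportion [O(m ^ (-1/2))] of the sets [S].  Averaging over [S], one chooses
    the coordinates one after the other: a separation pattern depends only on [D]
    and on one of the vertices restricted to [D], so the patterns with [m] below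
    about [sqrt d] are few and [o(d / log d)] coordinates deal with them; the at
    most [4 ^ d] others shrink by a power of [d] at every step, so that
    [O(d / log d)] further coordinates suffice. *)

(** * Greedy choice by averaging *)

Section Averaging.
Local Open Scope nat_scope.
Variables (S Z : finType) (bad : S -> Z -> bool).

(* Squares keep the proportion [sqrt (u / w)] of bad choices within [nat]. *)
Lemma exists_few_bad (A : {set Z}) (u w : nat) : 0 < #|S| ->
    (forall z, z \in A -> #|[set s | bad s z]| ^ 2 * w <= u * #|S| ^ 2) ->
  exists s, #|[set z in A | bad s z]| ^ 2 * w <= u * #|A| ^ 2.
Proof.
move=> S0 hA.
have [A0|[z0 z0A]] := set_0Vmem A.
  case/card_gt0P: S0 => s _; exists s.
  rewrite A0 (_ : [set _ in _ | _] = set0)%SET ?cards0 //.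
  by apply/setP => z; rewrite !inE.
pose N z := #|[set s | bad s z]|.
(* Bounding every [N] by its maximum over [A] lets the squared hypothesis be applied once, at the
   maximizer, after the double counting. *)
case: (@arg_maxnP _ z0 (mem A) N z0A) => z zA zmax.
have /existsP[s hs] : [exists s, #|S| * #|[set z in A | bad s z]| <= N z * #|A|].
  apply: contraT; rewrite negb_exists => /forallP h.
  have : \sum_(s : S) (N z * #|A|).+1 <=
         \sum_(s : S) #|S| * #|[set z in A | bad s z]|.
    by apply: leq_sum => s _; rewrite ltnNge h.
  rewrite sum_nat_const -big_distrr /= leq_pmul2l //.
  have -> : \sum_s #|[set z in A | bad s z]| = \sum_(z in A) N z.
    under eq_bigr => s _.
      rewrite -sum1_card (eq_bigl (fun z => (z \in A) && bad s z)); last first.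
        by move=> ?; rewrite inE.
      rewrite big_mkcondr; over.
    rewrite exchange_big /=; apply: eq_bigr => z' _.
    by rewrite -big_mkcond sum1dep_card.
  have : \sum_(z' in A) N z' <= \sum_(z' in A) N z.
    by apply: leq_sum => z' z'A; exact: zmax.
  rewrite sum_nat_const [#|_| * _]mulnC => h1 h2.
  by have := leq_trans h2 h1; rewrite ltnn.
exists s.
have S2 : 0 < #|S| ^ 2 by rewrite expn_gt0 S0.
rewrite -(leq_pmul2l S2) mulnA -expnMn.
apply: (@leq_trans ((N z * #|A|) ^ 2 * w)).
  by rewrite leq_mul2r leq_exp2r ?hs ?orbT.
rewrite expnMn mulnAC mulnA [_ * u]mulnC leq_mul2r.
by rewrite hA ?orbT.
Qed.

(** The hypothesis concerns each [z] separately, so it passes to the elements that survive the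
    earlier choices; each further choice gains a factor [u / w] in the square. *)
Lemma exists_seq_few_bad (A : {set Z}) (u w k : nat) : 0 < #|S| ->
    (forall z, z \in A -> #|[set s | bad s z]| ^ 2 * w <= u * #|S| ^ 2) ->
  exists2 ss : seq S, size ss = k &
    #|[set z in A | all (bad^~ z) ss]| ^ 2 * w ^ k <= u ^ k * #|A| ^ 2.
Proof.
move=> S0 hA; elim: k => [|k [ss <- IH]].
  exists [::] => //; rewrite !expn0 muln1 mul1n leq_exp2r //.
  by apply: subset_leq_card; apply/subsetP => z; rewrite inE => /andP[].
have [z|s hs] := @exists_few_bad [set z in A | all (bad^~ z) ss] u w S0.
  by rewrite inE => /andP[zA _]; exact: hA.
exists (s :: ss) => //=.
have -> : [set z in A | bad s z && all (bad^~ z) ss]%SET =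
          [set z in [set z in A | all (bad^~ z) ss] | bad s z]%SET.
  by apply/setP => z; rewrite !inE -andbA; congr (_ && _); rewrite andbC.
rewrite (expnS w) mulnA (leq_trans (leq_mul hs (leqnn _))) //.
by rewrite -mulnA (expnS u) -mulnA leq_mul2l IH orbT.
Qed.

Lemma exists_seq_no_bad (A : {set Z}) (u w k : nat) : 0 < #|S| ->
    (forall z, z \in A -> #|[set s | bad s z]| ^ 2 * w <= u * #|S| ^ 2) ->
    u ^ k * #|A| ^ 2 < w ^ k ->
  exists2 ss : seq S, size ss = k &
    forall z, z \in A -> has (fun s => ~~ bad s z) ss.
Proof.
move=> S0 hA huw; have [ss szss hss] := exists_seq_few_bad A u w k S0 hA.
exists ss => // z zA; rewrite has_predC; apply/negP => badz.
have := leq_ltn_trans hss huw.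
rewrite -{2}[w ^ k]mul1n ltn_mul2r [X in _ && X]ltnNge => /andP[_ /negP[]].
rewrite expn_gt0 orbF card_gt0; apply/set0Pn; exists z.
by rewrite inE zA.
Qed.

End Averaging.

(** * Proportion of sign sets that fail on a pattern, and how many sign sets suffice *)

Section Counting.
Local Open Scope nat_scope.

(** The factor [3 * n + 1] makes the induction close: the step reduces to
    [(2n+1)^2 (3n+4) <= 4 (n+1)^2 (3n+1)], whose sides differ by [n]. *)
Lemma central_bin_sqr n : 'C(n.*2, n) ^ 2 * (3 * n).+1 <= 16 ^ n.
Proof.
elim: n => [|n IH] //.
have rec : n.+1 * 'C(n.+1.*2, n.+1) = 2 * n.*2.+1 * 'C(n.*2, n).
  rewrite -mulnA (mul_bin_diag n.*2.+1 n) doubleS binS.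
  have -> : 'C(n.*2.+1, n) = 'C(n.*2.+1, n.+1).
    by rewrite -bin_sub; [congr ('C(_, _)) | ]; lia.
  by lia.
have p : 0 < n.+1 ^ 2 by rewrite expn_gt0.
rewrite -(leq_pmul2l p) mulnA -expnMn rec (expnS 16).
move: ('C(_, _)) (16 ^ n) IH => c e IH.
apply: (@leq_trans (c ^ 2 * (3 * n).+1 * (16 * n.+1 ^ 2))); last first.
  by rewrite mulnC -mulnA mulnCA leq_mul2l leq_mul2l IH !orbT.
rewrite expnMn mulnAC mulnC -mulnA leq_mul2l; apply/orP; right; nia.
Qed.

(** This is [|2t - m| <= 1] without subtraction; [2t - m] is the sum of [t] signs [+1] and [m - t]
    signs [-1]. *)
Definition near_half (m t : nat) := (t.*2 <= m.+1) && (m <= t.*2.+1).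

Lemma card_near_half_subsets (T : finType) (D : {set T}) :
  #|[set A : {set T} | (A \subset D) && near_half #|D| #|A|]| ^ 2 * (#|D| + 3)
    <= 4 * 4 ^ #|D|.
Proof.
set m := #|D|; set b := #|_|.
have sub (t : nat) : #|[set A : {set T} | (A \subset D) && (#|A| == t)]| = 'C(m, t).
  exact: cards_draws.
have [n [mE|mE]] : exists n, m = n.*2 \/ m = n.*2.+1.
  by exists m./2; rewrite -[m in m = _]odd_double_half -[m in _ \/ m = _]odd_double_half; case: (odd m); [right|left].
- have hb : b <= 'C(n.*2, n).
    rewrite -mE -sub; apply/subset_leq_card/subsetP => A; rewrite !inE mE.
    by rewrite /near_half => /andP[-> ?] /=; lia.
  have := central_bin_sqr n; rewrite mE -[in 4 ^ n.*2]mul2n expnM => h.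
  have : b ^ 2 <= 'C(n.*2, n) ^ 2 by rewrite leq_exp2r.
  rewrite (_ : 4 ^ 2 = 16) //; nia.
(* For odd [m] both [n] and [n.+1] are near half; by Pascal's rule their binomials add up to a
   central one. *)
- have hb : b <= 'C(n.+1.*2, n.+1).
    rewrite doubleS binS -mE -2!sub addnC -cardsUI.
    apply: leq_trans (leq_addr _ _).
    apply/subset_leq_card/subsetP => A; rewrite !inE mE.
    by rewrite /near_half => /andP[-> ?] /=; lia.
  have := central_bin_sqr n.+1.
  rewrite mE -expnS -doubleS -[in 4 ^ n.+1.*2]mul2n expnM => h.
  have : b ^ 2 <= 'C(n.+1.*2, n.+1) ^ 2 by rewrite leq_exp2r.
  rewrite (_ : 4 ^ 2 = 16) //; nia.
Qed.

Definition sym_diff {T : finType} (A B : {set T}) : {set T} :=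
  [set i | (i \in A) (+) (i \in B)].

(* [z = (D, Q)] stands for a pair of vertices with difference set [D], of which
   the second one has the coordinates in [Q] equal to [1] within [D]. *)
Definition unseparated {T : finType} (S : {set T}) (z : {set T} * {set T}) :=
  near_half #|z.1| #|z.1 :&: sym_diff S z.2|.

(** A set [S] is determined by its part outside [D], which is free, and by [D :&: sym_diff S Q],
    which must be near half of [D]. *)
Lemma card_unseparated (T : finType) (z : {set T} * {set T}) :
  #|[set S | unseparated S z]| ^ 2 * (#|z.1| + 3) <= 4 * #|{set T}| ^ 2.
Proof.
case: z => D Q; rewrite /unseparated /=.
pose H := [set A : {set T} | (A \subset D) && near_half #|D| #|A|].
pose f (S : {set T}) := (D :&: sym_diff S Q, S :\: D).
have finj : injective f.
  move=> S S' [/setP h1 /setP h2]; apply/setP => i.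
  by have := h1 i; have := h2 i; rewrite !inE; do !case: (_ \in _).
have hc : #|[set S | near_half #|D| #|D :&: sym_diff S Q|]| <=
    #|H| * 2 ^ (#|T| - #|D|).
  have -> : #|T| - #|D| = #|~: D| by rewrite [RHS]cardsCs setCK.
  rewrite -(card_imset _ finj) -card_powerset -cardsX.
  apply/subset_leq_card/subsetP => _ /imsetP[S hS ->].
  move: hS; rewrite !inE /= => ->; rewrite subsetIl /=.
  by apply/subsetP => i; rewrite !inE => /andP[].
have -> : #|{set T}| = 2 ^ #|D| * 2 ^ (#|T| - #|D|).
  by rewrite -expnD subnKC ?max_card // -cardsT -card_powerset powersetT cardsT.
have := card_near_half_subsets _ D; rewrite -/H.
set c := #|[set S | _]| in hc *; set e := 2 ^ (_ - _) in hc * => hH.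
have -> : 4 * (2 ^ #|D| * e) ^ 2 = 4 * 4 ^ #|D| * e ^ 2.
  by rewrite expnMn expnAC mulnA.
rewrite (leq_trans _ (leq_mul hH (leqnn (e ^ 2)))) //.
by rewrite mulnAC -expnMn leq_mul2r leq_exp2r ?hc ?orbT.
Qed.

Lemma card_small_subsets (T : finType) (r : nat) :
  #|[set A : {set T} | #|A| <= r]| <= #|T|.+1 ^ r.
Proof.
elim: r => [|r IH].
  rewrite expn0 -(cards1 (set0 : {set T})); apply/subset_leq_card/subsetP => A.
  by rewrite !inE leqn0 cards_eq0.
pose f (p : option T * {set T}) := if p.1 is Some a then a |: p.2 else p.2.
have -> : #|T|.+1 ^ r.+1 = #|[set: option T]| * #|T|.+1 ^ r.
  by rewrite expnS cardsT card_option.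
apply: leq_trans (leq_mul (leqnn _) IH); rewrite -cardsX.
apply: leq_trans (leq_imset_card f _).
apply/subset_leq_card/subsetP => A; rewrite inE => hA.
apply/imsetP; have [A0|[a aA]] := set_0Vmem A.
  by exists (None, A) => //; rewrite !inE /= A0 cards0.
exists (Some a, A :\ a); last by rewrite /f /= setD1K.
by rewrite !inE /=; have := cardsD1 a A; rewrite aA; lia.
Qed.

(** Since [#|z.1| + 3 >= 5], the squared proportion is at most [4 / 5], and
    [4 ^ 4 * 2 = 512 < 625 = 5 ^ 4]. *)
Lemma separate_few (T : finType) (A : {set {set T} * {set T}}) (j : nat) :
    0 < j -> (forall z, z \in A -> 2 <= #|z.1|) -> #|A| ^ 2 <= 2 ^ j ->
  exists2 ss : seq {set T}, size ss = 4 * j &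
    forall z, z \in A -> has (fun S => ~~ unseparated S z) ss.
Proof.
move=> j0 hA cA; apply: (exists_seq_no_bad _ _ _ A 4 5 (4 * j)).
- by apply/card_gt0P; exists set0.
- move=> z zA; apply: leq_trans (card_unseparated _ z).
  exact: leq_mul (leqnn _) (leq_add (hA z zA) (leqnn 3)).
- apply: leq_ltn_trans (leq_mul (leqnn _) cA) _.
  by rewrite !expnM -expnMn ltn_exp2r.
Qed.

(** The hypothesis compares exponents of 2 in [4 ^ k * (4 ^ #|T|) ^ 2 < (2 ^ h) ^ k]. *)
Lemma separate_large (T : finType) (h k : nat) : 2 * k + 4 * #|T| < h * k ->
  exists2 ss : seq {set T}, size ss = k &
    forall z : {set T} * {set T}, 2 ^ h <= #|z.1| -> has (fun S => ~~ unseparated S z) ss.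
Proof.
move=> hk; pose A := [set z : {set T} * {set T} | 2 ^ h <= #|z.1|].
have [||| ss szss hss] := exists_seq_no_bad _ _ unseparated A 4 (2 ^ h) k.
- by apply/card_gt0P; exists set0.
- move=> z; rewrite inE => zA; apply: leq_trans (card_unseparated _ z).
  exact: leq_mul (leqnn _) (leq_trans zA (leq_addr _ _)).
- apply: (@leq_ltn_trans (4 ^ k * (2 ^ #|T| * 2 ^ #|T|) ^ 2)).
    rewrite leq_mul2l leq_exp2r // (leq_trans (max_card _)) ?orbT //.
    by rewrite card_prod -!cardsT -powersetT card_powerset cardsT.
  rewrite -[4]/(2 ^ 2) -expnD -!expnM -expnD ltn_exp2l //.
  by move: hk; lia.
by exists ss => // z zA; apply: hss; rewrite inE.
Qed.

Lemma sqr_le_expn2 h : h.+1 ^ 2 <= 4 * 2 ^ h.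
Proof.
elim: h => [|[|[|h]] IH] //; rewrite (expnS 2) mulnCA.
by apply: leq_trans (leq_mul (leqnn 2) IH); rewrite -!mulnn; lia.
Qed.

Lemma separate_all (T : finType) : 0 < #|T| ->
  exists2 ss : seq {set T}, size ss * (trunc_log 2 #|T|).+1 <= 322 * #|T| &
    forall z : {set T} * {set T}, z.2 \subset z.1 -> 2 <= #|z.1| ->
      has (fun S => ~~ unseparated S z) ss.
Proof.
set d := #|T| => d0; set L := trunc_log 2 d.
have /andP[Ld dL] : 2 ^ L <= d < 2 ^ L.+1 by apply: trunc_log_bounds.
have cardz : #|{: {set T} * {set T}}| = 2 ^ (2 * d).
  by rewrite card_prod -!cardsT -powersetT card_powerset cardsT -expnD addnn mul2n.
(* For bounded [L], [16 * d] sets separate everything at once, and [16 * 8 <= 322]. *)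
have [L7|L8] := ltnP L 8.
  have [||| ss szss hss] := @separate_few T [set z : {set T} * {set T} | 2 <= #|z.1|] (4 * d).
  - by lia.
  - by move=> z; rewrite inE.
  - rewrite (_ : 4 * d = 2 * d * 2); last by lia.
    by rewrite expnM leq_exp2r // -cardz max_card.
  exists ss; first by rewrite szss; nia.
  by move=> z _ z2; apply: hss; rewrite inE.
pose h := L./2; pose r := 2 ^ h.
have hL : h.*2 <= L <= h.*2.+1 by rewrite /h; lia.
have r2d : r * r <= d.
  by rewrite /r -expnD addnn (leq_trans _ Ld) // leq_exp2l //; lia.
pose A := [set z : {set T} * {set T} | [&& z.2 \subset z.1, 2 <= #|z.1| & #|z.1| <= r]].
have r0 : 0 < r by rewrite expn_gt0.
(* Both components of a small pattern have at most [r] elements, hence [#|A| <= 2 ^ (2 * r * L.+1)];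
   squaring doubles the exponent. *)
have [||| ss1 sz1 hs1] := @separate_few T A (4 * r * L.+1).
- by rewrite !muln_gt0 r0.
- by move=> z; rewrite inE => /and3P[].
- have cA : #|A| <= 2 ^ (2 * r * L.+1).
    pose B := [set A : {set T} | #|A| <= r].
    have cB : #|B| <= 2 ^ (r * L.+1).
      rewrite (leq_trans (card_small_subsets _ _)) // mulnC expnM leq_exp2r //.
    apply: (@leq_trans (#|B| * #|B|)).
      rewrite -cardsX; apply/subset_leq_card/subsetP => z.
      rewrite !inE => /and3P[/subset_leq_card z21 _ z1].
      by rewrite z1 (leq_trans z21).
    by rewrite -mulnA mul2n -addnn expnD leq_mul.
  rewrite (_ : 4 * r * L.+1 = 2 * r * L.+1 * 2); last by lia.
  by rewrite expnM leq_exp2r.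
(* From [L >= 8] follows [h - 2 >= L / 8], so [k * L > 32 * d] yields [(h - 2) * k > 4 * d]. *)
have [|ss2 sz2 hs2] := @separate_large T h ((32 * d) %/ L).+1.
  have := ltn_ceil (32 * d) (ltn_trans _ L8 : 0 < L); move/(_ isT).
  by move: (_ %/ _).+1 => k hk; move: hL L8 hk; rewrite -/d; clear; nia.
(* The constant is [322 = 256 + 66], one summand for each list. *)
exists (ss1 ++ ss2).
  rewrite size_cat sz1 sz2 mulnDl.
  have := sqr_le_expn2 h; rewrite -/r => hr.
  have := leq_trunc_div (32 * d) L.
  move: (_ %/ _) => k kL.
  have Lr : L.+1 ^ 2 <= 16 * r.
    apply: (@leq_trans ((2 * h.+1) ^ 2)); first by rewrite leq_exp2r //; lia.
    by rewrite expnMn; lia.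
  have few : 4 * (4 * r * L.+1) * L.+1 <= 256 * d.
    rewrite (_ : _ * L.+1 = 16 * r * L.+1 ^ 2); last by rewrite -mulnn; ring.
    apply: leq_trans (leq_mul (leqnn _) Lr) _.
    by rewrite (_ : _ * _ = 256 * (r * r)) ?leq_mul2l //; ring.
  have large : k.+1 * L.+1 <= 66 * d.
    have Ld' : L <= d by apply: leq_trans Ld; exact/ltnW/ltn_expl.
    by move: kL Ld' L8; clear; nia.
  by rewrite (leq_trans (leq_add few large)) // -mulnDl.
move=> z z21 z2; rewrite has_cat; apply/orP.
have [zr|zr] := leqP #|z.1| r; [left|right].
  by apply: hs1; rewrite inE z21 z2.
by apply: hs2; exact: ltnW.
Qed.

End Counting.

(** * Signed sums of vertices and their differences *)

Section SignedSums.
Import GRing.Theory Num.Theory.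
Local Open Scope ring_scope.
Variables (R : realDomainType) (d : nat).
Implicit Types (x y : d.-tuple bool) (S : {set 'I_d}).

Definition signed_sum S x : R :=
  \sum_i (if i \in S then 1 else -1) * (tnth x i)%:R.

Definition diff_set x y := [set i | tnth x i != tnth y i].

Definition diff_pattern x y : {set 'I_d} * {set 'I_d} :=
  (diff_set x y, [set i in diff_set x y | tnth y i]).

(** A coordinate where [x] and [y] differ contributes [+1] exactly when one of [i \in S] and
    [tnth y i] holds but not both, and [-1] otherwise. *)
Lemma signed_sumB S x y : signed_sum S x - signed_sum S y =
  #|diff_set x y :&: sym_diff S (diff_pattern x y).2|.*2%:R
    - #|diff_set x y|%:R.
Proof.
have cardR (A : {set 'I_d}) : #|A|%:R = \sum_i (i \in A)%:R :> R.
  by rewrite -sum1_card natr_sum big_mkcond; apply: eq_bigr => i _; case: ifP.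
rewrite -muln2 natrM !cardR mulr_suml -!sumrB.
apply: eq_bigr => i _; rewrite !inE.
by case: (i \in S); case: (tnth x i); case: (tnth y i) => /=; ring.
Qed.

Lemma unseparatedE S x y :
  unseparated S (diff_pattern x y) = (`|signed_sum S x - signed_sum S y| <= 1).
Proof.
rewrite signed_sumB /unseparated /near_half /=; move: #|_| #|_| => t m.
by rewrite ler_norml andbC lerBlDl lerBrDr [-1 + _]addrC lerBlDr !natr1 !ler_nat.
Qed.

End SignedSums.

(* Boxes built from separating sign sets, and the final bound *)
From mathcomp Require Import all_classical all_reals all_analysis.
Import Order.TTheory GRing.Theory Num.Theory.
Local Open Scope ring_scope.

Lemma box_representable_separated (R : realType) (d : nat)
    (ss : seq {set 'I_d}) :
    (forall x y, (2 <= #|diff_set _ x y|)%N ->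
       has (fun S => ~~ unseparated S (diff_pattern _ x y)) ss) ->
  box_representable R (hypercube d) (size ss).
Proof.
move=> sep.
pose f (x : d.-tuple bool) : 'rV[R]_(size ss) :=
  \row_i signed_sum R d (tnth (in_tuple ss) i) x.
exists (fun x =>
  [set p | forall i, p ord0 i \in `[f x ord0 i, (f x + const_mx 1) ord0 i]%R]%classic).
split=> [x|x y nxy].
  by exists (f x), (f x + const_mx 1); split=> // i; rewrite !mxE lerDl.
have f1E z i : (f z + const_mx 1) ord0 i = f z ord0 i + 1 by rewrite !mxE.
have unsepE i : unseparated (tnth (in_tuple ss) i) (diff_pattern _ x y) =
    (`|f x ord0 i - f y ord0 i| <= 1) by rewrite !mxE (unseparatedE R).
split=> [/eqP axy|[p [px py]]].
  have D1 : #|diff_set _ x y| = 1%N by [].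
  (* Two unit intervals whose left ends are at distance at most 1 share the larger left end. *)
  pose q : 'rV[R]_(size ss) := \row_i Num.max (f x ord0 i) (f y ord0 i).
  have qE i : q ord0 i = Num.max (f x ord0 i) (f y ord0 i) by rewrite mxE.
  exists q.
  have near i : `|f x ord0 i - f y ord0 i| <= 1.
    rewrite -unsepE /unseparated /near_half /= D1.
    set T := _ :&: _; have : (#|T| <= 1)%N.
      by rewrite -D1 subset_leq_card // finset.subsetIl.
    by case: #|T| => [|[|]].
  split=> i; rewrite in_itv /= qE f1E le_max ge_max lexx ?orbT lerDl ler01 /=;
    have := near i; rewrite ler_norml; lra.
apply/negPn/negP => nadj.
have D2 : (2 <= #|diff_set _ x y|)%N.
  have D0 : (0 < #|diff_set _ x y|)%N.
    rewrite card_gt0; apply: contraNneq nxy => D0; apply/eqP/eq_from_tnth => i.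
    by apply/eqP; have := finset.in_set0 i; rewrite -D0 inE => /negbFE.
  by move: D0 nadj; rewrite /= /hypercube_adj -/(diff_set d x y); case: #|_| => [|[]].
have /hasP[S /(nthP finset.set0)[i i_lt <-]] := sep x y D2.
have -> : nth finset.set0 ss i = tnth (in_tuple ss) (Ordinal i_lt).
  by rewrite (tnth_nth finset.set0).
rewrite unsepE => /negP; apply.
have := px (Ordinal i_lt); have := py (Ordinal i_lt).
rewrite !in_itv /= !f1E ler_norml.
move: (f x _ _) (f y _ _) (p _ _) => a b c; lra.
Qed.

Theorem mainTheorem3 (R : realType) :
  exists c : R, forall d : nat, (2 <= d)%N ->
    (boxicity R (hypercube d))%:R <= c * d%:R / ln (d%:R : R).
Proof.
exists 322%:R => d d2.
have [|ss hs hss] := separate_all 'I_d; first by rewrite card_ord; lia.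
rewrite card_ord in hs.
have box : (boxicity R (hypercube d) <= size ss)%N.
  rewrite /boxicity; case: ex_minnP => k _; apply; apply/asboolP.
  apply: box_representable_separated => x y xy; apply: (hss (diff_pattern d x y)) => //.
  by apply/fintype.subsetP => i; rewrite inE => /andP[].
have ln0 : 0 < ln (d%:R : R) by rewrite ln_gt0 // ltr1n.
rewrite ler_pdivlMr // -natrM.
apply: (@le_trans _ _ (boxicity R (hypercube d) * (trunc_log 2 d).+1)%:R).
  (* It remains that [ln d <= L + 1] for the binary logarithm [L]: indeed
     [d < 2 ^ (L + 1) <= e ^ (L + 1)], as [1 + 1 <= e]. *)
  rewrite natrM ler_wpM2l ?ler0n //.
  rewrite -[leRHS]expRK ler_ln ?posrE ?expR_gt0 ?ltr0n //; last by lia.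
  apply: (@le_trans _ _ (2 ^+ (trunc_log 2 d).+1)).
    by rewrite -natrX ler_nat ltnW // trunc_log_ltn.
  rewrite -[X in expR X]mulr1 expRM_natl lerXn2r ?nnegrE ?expR_ge0 //.
  exact: expR_ge1Dx.
by rewrite ler_nat (leq_trans _ hs) // leq_mul2r box orbT.
Qed.
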